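(* For every cardinal $\tau\geq\omega_1$, there exists a Tychonoff $\tau$-pseudocompact space $X$ with two regular-closed subsets $A,B\subset X$ such that $A$ is a zero set of $X$, $B$ is $C$-embedded in $X$, and neither $A$ nor $B$ (with the subspace topology) is $\tau$-pseudocompact.
   Context: All spaces are Tychonoff ($T_{3\frac12}$). For an infinite cardinal $\tau$, $\mathbb R^\tau$ is the product of $\tau$ copies of the real line with the product topology. A space $X$ is $\tau$-pseudocompact if for every continuous $f:X\rightarrow\mathbb R^\tau$, $f(X)$ is a closed subset of $\mathbb R^\tau$. (By a known theorem of Kennison, this is equivalent to: every family $\mathcal F$ of zero sets of $X$ with the finite intersection property and $|\mathcal F|\leq\tau$ has $\bigcap\mathcal F\neq\emptyset$.) A subset $H$ of a space $X$ is regular-closed if it is the closure in $X$ of an open subset of $X$; $H$ is a zero set of $X$ if there is a continuous $f:X\rightarrow[0,1]$ with $H=f^{-1}(0)$; $H$ is $C$-embedded in $X$ if every continuous $f:H\rightarrow\mathbb R$ extends to a continuous $g:X\rightarrow\mathbb R$. *)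

(* Defs.v *)
From HB Require Import structures.
From mathcomp Require Import all_boot all_order all_algebra.
From mathcomp Require Import all_classical all_reals all_analysis.

Set Implicit Arguments.
Unset Strict Implicit.
Unset Printing Implicit Defensive.

Import Order.TTheory GRing.Theory Num.Theory.
Import numFieldNormedType.Exports.

Local Open Scope classical_set_scope.
Local Open Scope ring_scope.

(* T_{3 1/2}: completely regular and T_1. That points and closed sets are
   separated by real-valued functions is [uniform_separatorP]. *)
Definition tychonoff_space (X : topologicalType) : Prop :=
  accessible_space X /\ completely_regular_space X.

(* A cardinal tau is represented by a type K of that cardinality; R^tau is then
   {ptws K -> R}, i.e. K -> R with the product topology. *)
Definition tau_pseudocompact (R : realType) (K : Type) (X : topologicalType) :
    Prop :=
  forall f : X -> {ptws K -> R}, continuous f -> closed (range f).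

Definition regular_closed (X : topologicalType) (H : set X) : Prop :=
  exists2 U : set X, open U & H = closure U.

Definition zero_set (R : realType) (X : topologicalType) (H : set X) : Prop :=
  exists f : X -> R,
    [/\ continuous f, forall x, 0 <= f x <= 1 & H = f @^-1` [set 0]].

(* [set_type H] is the subtype of points of H with the topology induced from X;
   it is not the library's [subspace H], whose carrier is all of X. *)
Definition C_embedded (R : realType) (X : topologicalType) (H : set X) : Prop :=
  forall f : set_type H -> R, continuous f ->
    exists2 g : X -> R, continuous g & forall x : set_type H, g (val x) = f x.

Lemma regular_closedE (X : topologicalType) (H : set X) :
  regular_closed H <-> regclosed H.
Proof.
split=> [[U oU ->]|cH]; first exact: closure_open_regclosed.
by exists (H°)%classic; [exact: open_interior | rewrite cH].
Qed.

(* Main.v *)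
Require Import Defs.
From mathcomp Require Import all_boot all_order all_algebra.
From mathcomp Require Import all_classical all_reals all_analysis.
From mathcomp Require Import lra.

Local Open Scope classical_set_scope.

(** The space is what remains of a union of four cubes in a product of lines
    once the common corner 0 is removed. Write tau for the cardinality of K.
    The coordinates are tau small ones, more than tau large ones, and three
    single axes u, v and t (SmallAxis, LargeAxis and LinkAxis below). The cubes
    are [0,1]^S for S one of
      small + u,   large + v,   small + t,   large + t.

    A continuous function on a cube of uncountable dimension with one corner
    removed depends on countably many coordinates only
    (countable_dependence), so it extends over the corner. Here the four
    extensions agree at 0: neighbouring cubes share a face in which 0 is not
    isolated. Hence tau continuous functions on the space all extend to the
    compact union of the cubes, and as there are more than tau large
    coordinates, one of these is ignored by every function; on its unit
    point all the functions take the values that they have at 0. The image in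
    R^tau is therefore that of a compact set, and it is closed.

    Now A is cut out by t = 0: the cubes small + u and large + v, which touch
    only in the missing corner and so form disjoint open pieces of A. The
    first one is B. In it the corner is an intersection of tau open sets, so a
    map to R^tau that vanishes only there has an image which is not closed
    (not_pseudocompact_of_small_face). The other piece of A is disjoint from B
    and closed, so A fails in the same way. B is C-embedded because its
    functions extend over the corner and the closed cube is a retract of the
    union of the cubes. The axes u and v make A and B regular closed: they are
    the closures of the sets where u or v, resp. u, is nonzero. *)

(** * Cubes in a product of lines *)

Lemma countable_setU {T : Type} (J J' : set T) :
  countable J -> countable J' -> countable (J `|` J').
Proof.
by move=> cJ cJ'; rewrite -bigcup2E; apply: bigcup_countable => // -[|[|]].
Qed.

Section ProductOfLines.
Import Order.TTheory GRing.Theory Num.Theory.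
Import numFieldNormedType.Exports.
Local Open Scope ring_scope.
Context {R : realType} {I : Type}.
Local Notation P := {ptws I -> R}.
Implicit Types (x y : P) (S J : set I) (i : I).

Lemma cvg_ptws {F : set_system P} (x : P) : Filter F ->
  (forall i, (y i @[y --> F]) --> x i) -> F --> x.
Proof.
move=> FF h; apply/cvg_sup => i.
apply/cvg_image; first by rewrite eqEsubset; split=> v // _; exists (cst v).
apply: cvg_trans (h i) => W /=; rewrite ?nbhs_simpl /fmap /= => W'.
exists ((fun y : P => y i) @^-1` W) => //.
by rewrite eqEsubset; split => [j [? + <-//]|j Wj]; exists (fun _ => j).
Qed.

Lemma continuous_coord i : continuous (fun y : P => y i).
Proof. exact: (@proj_continuous {classic I} (fun=> R) i). Qed.

Lemma continuous_ptws {T : topologicalType} (f : T -> P) :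
  (forall i, continuous (fun z => f z i)) -> continuous f.
Proof. by move=> fc z; apply: cvg_ptws => i; exact: fc. Qed.

Lemma hausdorff_ptws : hausdorff_space P.
Proof.
by apply: (@hausdorff_product {classic I} (fun=> R)) => ?; exact: Rhausdorff.
Qed.

(** A basic neighbourhood constrains finitely many coordinates, but countably
    many suffice below. This form needs no description of a base: the sets that
    contain all points agreeing with x on some countable set form a filter,
    which converges to x coordinatewise. *)
Lemma nbhs_ptws_countable x (N : set P) : nbhs x N ->
  exists2 F : set I, countable F & forall y, (forall i, F i -> y i = x i) -> N y.
Proof.
pose G : set_system P := fun N => exists2 F : set I, countable F &
  forall y, (forall i, F i -> y i = x i) -> N y.
have GF : Filter G.
  split; first by exists set0 => //; exact: countable0.
    move=> A B [F cF FA] [F' cF' FB]; exists (F `|` F').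
      exact: countable_setU.
    move=> y yx; split; [apply: FA|apply: FB] => i Fi; apply: yx; [left|right];
      exact: Fi.
  by move=> A B AB [F cF FA]; exists F => // y /FA /AB.
suff: G --> x by move=> /(_ N); exact.
apply: cvg_ptws => i W Wxi; exists [set i]; first exact: countable1.
by move=> y /(_ i erefl) yx; rewrite /preimage/= yx; exact: nbhs_singleton.
Qed.

Definition set_coord x i (a : R) : P := fun j => if `[< j = i >] then a else x j.

Lemma set_coord_eq x i a : set_coord x i a i = a.
Proof. by rewrite /set_coord; case: asboolP. Qed.

Lemma set_coord_neq x i a j : j <> i -> set_coord x i a j = x j.
Proof. by move=> ji; rewrite /set_coord; case: asboolP. Qed.

Lemma set_coord_id x i : set_coord x i (x i) = x.
Proof. by apply/funext => j; rewrite /set_coord; case: asboolP => // ->. Qed.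

Lemma continuous_set_coord i a : continuous (fun x => set_coord x i a).
Proof.
apply: continuous_ptws => j; rewrite /set_coord.
case: asboolP => _; last exact: continuous_coord.
exact: (@cst_continuous _ _ a).
Qed.

Lemma continuous_coord_path x i : continuous (set_coord x i).
Proof.
apply: continuous_ptws => j; rewrite /set_coord.
case: asboolP => _; last exact: (@cst_continuous _ _ (x j)).
by move=> z; exact: cvg_id.
Qed.

(** The cube [0,1]^S, embedded in the whole product by zero coordinates. *)
Definition cube S : set P :=
  [set x | forall i, 0 <= x i <= 1 /\ (~ S i -> x i = 0)].

Definition punctured_cube S : set P := [set x | cube S x /\ exists i, x i != 0].

Lemma cube_cst0 S : cube S (cst 0).
Proof. by move=> i; rewrite lexx ler01. Qed.

Lemma cube_set_coord S x i a : S i -> 0 <= a <= 1 -> cube S x ->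
  cube S (set_coord x i a).
Proof.
move=> Si a01 Sx j; have [->|ji] := pselect (j = i).
  by rewrite set_coord_eq.
by rewrite set_coord_neq.
Qed.

Lemma cube_neq0 S x i : cube S x -> x i != 0 -> S i.
Proof.
by move=> Sx xi0; apply: contrapT => /(proj2 (Sx i)) xi; rewrite xi eqxx in xi0.
Qed.

Lemma punctured_cube_set_coord S x i a : S i -> 0 < a <= 1 -> cube S x ->
  punctured_cube S (set_coord x i a).
Proof.
move=> Si /andP[a0 a1] Sx; split.
  by apply: cube_set_coord => //; rewrite (ltW a0) a1.
by exists i; rewrite set_coord_eq gt_eqF.
Qed.

Lemma cubeE S : cube S =
  [set x | forall i, (if `[< S i >] then `[0, 1]%classic else [set (0 : R)]) (x i)].
Proof.
apply/seteqP; split=> x Sx i; have := Sx i; case: asboolP => Si //=.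
- by rewrite in_itv/= => -[].
- by move=> [_ ->].
- by move->; rewrite lexx ler01.
Qed.

Lemma compact_cube S : compact (cube S).
Proof.
rewrite cubeE; apply: (@tychonoff {classic I} (fun=> R)
  (fun i => if `[< S i >] then `[0, 1]%classic else [set 0])) => i.
by case: asboolP => _; [exact: segment_compact|exact: compact_set1].
Qed.

Lemma closed_cube S : closed (cube S).
Proof. apply: compact_closed; [exact: hausdorff_ptws|exact: compact_cube]. Qed.

End ProductOfLines.

(** * Functions on a punctured cube *)

Section Dependence.
Import Order.TTheory GRing.Theory Num.Theory.
Import numFieldNormedType.Exports.
Local Open Scope ring_scope.
Context {R : realType} {I : Type}.
Local Notation P := {ptws I -> R}.
Implicit Types (x y : P) (S J : set I) (i : I) (g : P -> R).

Lemma within_nbhs {S g x} {d : R} : {within punctured_cube S, continuous g} ->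
  punctured_cube S x -> 0 < d ->
  \forall y \near x, punctured_cube S y -> `|g x - g y| < d.
Proof.
by move=> /subspace_continuousP gc /gc /cvgrPdist_lt/[apply].
Qed.

(** By continuity x and y may be replaced by points that equal 1 at all but
    countably many coordinates of the cube. Both are filled in alike outside a
    countable set N, so they still agree on J and now agree outside N too. *)
Lemma sigma_approximation S g (e : R) x y : 0 < e ->
  {within punctured_cube S, continuous g} -> ~ countable S ->
  punctured_cube S x -> punctured_cube S y ->
  e < `|g x - g y| -> forall J, countable J -> (forall i, J i -> x i = y i) ->
  exists w : (P * P) * set I,
   [/\ countable w.2, punctured_cube S w.1.1, punctured_cube S w.1.2,
    e / 2 < `|g w.1.1 - g w.1.2| &
    (forall i, J i -> w.1.1 i = w.1.2 i) /\
    (forall i, ~ w.2 i -> w.1.1 i = w.1.2 i /\ (S i -> w.1.1 i = 1))].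
Proof.
move=> e0 gc uS Sx Sy exy J cJ Jxy.
have e4 : 0 < e / 4 by rewrite divr_gt0.
have [F cF Fx] := nbhs_ptws_countable _ _ (within_nbhs gc Sx e4).
have [G cG Gy] := nbhs_ptws_countable _ _ (within_nbhs gc Sy e4).
pose N := J `|` (F `|` G).
have cN : countable N by do ![apply: countable_setU => //].
pose fill z : P := fun i => if `[< N i >] then z i else if `[< S i >] then 1 else 0.
have fillN z i : N i -> fill z i = z i by rewrite /fill; case: asboolP.
have fillC z i : ~ N i -> fill z i = if `[< S i >] then 1 else 0.
  by rewrite /fill; case: asboolP.
have [k Sk Nk] : exists2 k, S k & ~ N k.
  apply: contrapT => nk; apply: uS; apply: sub_countable cN.
  by apply: subset_card_le => i Si; apply: contrapT => nNi; apply: nk; exists i.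
have Sfill z : cube S z -> punctured_cube S (fill z).
  move=> Sz; split; last first.
    by exists k; rewrite fillC//; case: asboolP => // _; rewrite oner_neq0.
  move=> i; rewrite /fill; case: asboolP => _; first exact: Sz.
  by case: asboolP => Si; rewrite ?lexx ler01; split.
have dx : `|g x - g (fill x)| < e / 4.
  by apply: (Fx (fill x) _ (Sfill _ Sx.1)) => i Fi; apply: fillN; right; left.
have dy : `|g y - g (fill y)| < e / 4.
  by apply: (Gy (fill y) _ (Sfill _ Sy.1)) => i Fi; apply: fillN; right; right.
exists ((fill x, fill y), N); split => //=.
- exact/Sfill/Sx.1.
- exact/Sfill/Sy.1.
- have : `|g x - g y| <= `|g x - g (fill x)| + `|g (fill x) - g (fill y)|
       + `|g y - g (fill y)|.
    rewrite [X in _ <= _ + X]distrC.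
    apply: le_trans (lerD (ler_distD (g (fill x)) (g x) (g (fill y))) (lexx _)).
    exact: ler_distD.
  lra.
split=> i; first by move=> Ji; rewrite !fillN ?Jxy//; left.
by move=> Ni; rewrite !fillC//; case: asboolP.
Qed.

(** Otherwise choose points x_n and y_n of the preceding kind which agree on an
    increasing sequence of countable sets that absorbs every coordinate where
    they may differ or fail to equal 1. Then at each coordinate x_n and y_n
    agree eventually, so a cluster point of the pairs lies on the diagonal,
    contradicting continuity there. It is not the removed corner, because
    uncountably many of its coordinates are 1. *)
Lemma countable_dependence_eps S g (e : R) : ~ countable S ->
  {within punctured_cube S, continuous g} -> 0 < e ->
  exists2 J, countable J & forall x y, punctured_cube S x -> punctured_cube S y ->
    (forall i, J i -> x i = y i) -> `|g x - g y| <= e.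
Proof.
move=> uS gc e0; apply: contrapT => nJ.
have /choice[w wP] : forall J, exists w : (P * P) * set I, countable J ->
   [/\ countable w.2, punctured_cube S w.1.1, punctured_cube S w.1.2,
    e / 2 < `|g w.1.1 - g w.1.2| &
    (forall i, J i -> w.1.1 i = w.1.2 i) /\
    (forall i, ~ w.2 i -> w.1.1 i = w.1.2 i /\ (S i -> w.1.1 i = 1))].
  move=> J; have [cJ|] := pselect (countable J); last first.
    by move=> ncJ; exists ((cst 0, cst 0), set0).
  have [x [y [Sx Sy Jxy exy]]] : exists x y, [/\ punctured_cube S x,
      punctured_cube S y, (forall i, J i -> x i = y i) & e < `|g x - g y|].
    apply: contrapT => nxy; apply: nJ; exists J => // x y Sx Sy Jxy.
    by rewrite leNgt; apply/negP => exy; apply: nxy; exists x, y.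
  by have [v vP] := sigma_approximation _ _ _ _ _ e0 gc uS Sx Sy exy _ cJ Jxy;
    exists v.
(* each stage adds the coordinates which the chosen pair has used *)
pose stage n := iter n (fun J => J `|` (w J).2) set0.
have cstage n : countable (stage n).
  elim: n => [|n IH]; first exact: countable0.
  by apply: countable_setU => //; have [] := wP _ IH.
have stageS n m : (n <= m)%N -> stage n `<=` stage m.
  move=> /subnK <-; elim: (m - n)%N => // d IH; rewrite addSn.
  by apply: subset_trans IH _ => i; left.
pose limit := \bigcup_n stage n.
have climit : countable limit by apply: bigcup_countable.
pose u n := (w (stage n)).1.
have uP n := wP _ (cstage n).
have ueq i : \forall n \near \oo, (u n).1 i = (u n).2 i.
  have [[m _ im]|ni] := pselect (limit i).
    exists m => // n /= mn; have [_ _ _ _ [+ _]] := uP n.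
    by apply; exact: stageS mn _ im.
  near=> n; have [_ _ _ _ [_ /(_ i) []//]] := uP n.
  by move=> wi; apply: ni; exists n.+1 => //; right.
have u1 i : S i -> ~ limit i -> forall n, (u n).1 i = 1.
  move=> Si ni n; have [_ _ _ _ [_ /(_ i) []]] := uP n; last by move=> _; apply.
  by move=> wi; apply: ni; exists n.+1 => //; right.
have [[p q] [[/= Sp Sq]]] : (cube S `*` cube S) `&` cluster (u @ \oo) !=set0.
  apply: (compact_setX (compact_cube S) (compact_cube S)); exists 0%N => // n _.
  by have [_ Sx Sy _ _] := uP n; split; [exact: Sx.1|exact: Sy.1].
move=> clpq.
have clos (A : set (P * P)) : closed A -> (\forall n \near \oo, A (u n)) -> A (p, q).
  by move=> cA uA; move: clpq; rewrite clusterE => /(_ A uA); exact: cA.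
have c1 i : continuous (fun v : P * P => v.1 i).
  by move=> v; apply: (@continuous_comp _ _ _ fst (fun z : P => z i));
    [exact: cvg_fst|exact: continuous_coord].
have c2 i : continuous (fun v : P * P => v.2 i).
  by move=> v; apply: (@continuous_comp _ _ _ snd (fun z : P => z i));
    [exact: cvg_snd|exact: continuous_coord].
have pq : p = q.
  apply/funext => i.
  suff : [set v : P * P | v.1 i - v.2 i = 0] (p, q).
    by move/eqP; rewrite subr_eq0 => /eqP.
  apply: clos.
    apply: (@preimage_closed _ _ (fun v : P * P => v.1 i - v.2 i) [set 0]).
      by move=> v _; exact: (continuousB (c1 i v) (c2 i v)).
    exact: closed_eq.
  by have := ueq i; apply: filterS => n /= ->; rewrite subrr.
have [k Sk Nk] : exists2 k, S k & ~ limit k.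
  apply: contrapT => nk; apply: uS; apply: sub_countable climit.
  by apply: subset_card_le => i Si; apply: contrapT => nNi; apply: nk; exists i.
have pk : p k = 1.
  apply: (clos [set v | v.1 k = 1]); last exact: nearW (u1 _ Sk Nk).
  apply: (@preimage_closed _ _ (fun v : P * P => v.1 k) [set 1]).
    by move=> v _; exact: c1.
  exact: closed_eq.
have Pp : punctured_cube S p by split => //; exists k; rewrite pk oner_neq0.
have e4 : 0 < e / 4 by rewrite divr_gt0.
pose N : set P := fun y => punctured_cube S y -> `|g p - g y| < e / 4.
have Np : nbhs p N := within_nbhs gc Pp e4.
have [] := clpq (range u) (N `*` N).
- by exists 0%N => // n _; exists n.
- by rewrite -pq; exists (N, N).
move=> _ [[n _ <-] [Nx Ny]]; have [_ Sx Sy + _] := uP n.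
have := Nx Sx; have := Ny Sy; rewrite -/(u n) /=.
have := ler_distD (g p) (g (u n).1) (g (u n).2).
by rewrite (distrC (g (u n).1) (g p)); lra.
Unshelve. all: by end_near. Qed.

Lemma countable_dependence S g : ~ countable S ->
  {within punctured_cube S, continuous g} ->
  exists2 J, countable J & forall x y, punctured_cube S x -> punctured_cube S y ->
    (forall i, J i -> x i = y i) -> g x = g y.
Proof.
move=> uS gc.
have /choice[J JP] : forall n : nat, exists J, countable J /\
    forall x y, punctured_cube S x -> punctured_cube S y ->
    (forall i, J i -> x i = y i) -> `|g x - g y| <= n.+1%:R^-1.
  move=> n; have [|J cJ JP] := countable_dependence_eps S g n.+1%:R^-1 uS gc.
    by rewrite invr_gt0.
  by exists J.
exists (\bigcup_n J n); first by apply: bigcup_countable => // n _; have [] := JP n.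
move=> x y Sx Sy xy; apply/eqP; rewrite -subr_eq0 -normr_le0.
apply/ler_addgt0Pr => e e0; rewrite add0r.
have [n ne] := ltr_add_invr e0; rewrite add0r in ne.
apply: le_trans (ltW ne); apply: (JP n).2 => // i Ji; apply: xy.
by exists n.
Qed.

(** Setting an ignored coordinate to 1 does not change g on the punctured cube,
    and it moves the corner into the punctured cube; so x |-> g (x with x_i = 1) is a continuous
    extension of g to the whole cube. *)
Lemma face_extension S g : ~ countable S ->
  {within punctured_cube S, continuous g} ->
  exists2 J, countable J & forall i, S i -> ~ J i ->
    {within cube S, continuous (fun x => g (set_coord x i 1))} /\
    forall x, punctured_cube S x -> g (set_coord x i 1) = g x.
Proof.
move=> uS gc; have [J cJ JP] := countable_dependence S g uS gc.
exists J => // i Si Ji; split.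
  apply/subspace_continuousP => x Sx; apply/cvgrPdist_lt => e e0.
  have := within_nbhs gc (punctured_cube_set_coord _ _ _ 1 Si _ Sx) e0.
  rewrite ltr01 lexx => /(_ isT) gx.
  have cx := @continuous_set_coord R I i 1 x.
  have {}gx : \forall y \near x, punctured_cube S (set_coord y i 1) ->
      `|g (set_coord x i 1) - g (set_coord y i 1)| < e by exact: cx gx.
  rewrite near_withinE; apply: filterS gx => y gy Sy.
  by apply: gy; apply: punctured_cube_set_coord => //; rewrite ltr01 lexx.
move=> x Sx; apply: JP => //.
  by apply: punctured_cube_set_coord Sx.1 => //; rewrite ltr01 lexx.
by move=> j Jj; rewrite set_coord_neq// => ji; apply: Ji; rewrite -ji.
Qed.

Lemma nbhs0_small (N : set R) : nbhs 0 N -> exists2 s, 0 < s <= 1 & N s.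
Proof.
move=> /nbhs_ballP[e /= e0 Ne]; have e20 : 0 < e / 2 by rewrite divr_gt0.
exists (Num.min 1 (e / 2)); first by rewrite lt_min ltr01 e20 ge_min lexx.
apply: Ne; rewrite /ball/= sub0r normrN ger0_norm.
  by rewrite gt_min; apply/orP; right; lra.
by rewrite le_min ler01 ltW.
Qed.

Lemma nbhs_small_coord x i (N : set P) : x i = 0 -> nbhs x N ->
  exists2 s, 0 < s <= 1 & N (set_coord x i s).
Proof.
move=> xi0 Nx; apply: nbhs0_small.
by apply: (continuous_coord_path x i 0); rewrite -xi0 set_coord_id.
Qed.

(** Along the shared axis i both functions tend to their values at 0. *)
Lemma extensions_agree0 S S' i (g g' : P -> R) : S i -> S' i ->
  {within cube S, continuous g} -> {within cube S', continuous g'} ->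
  (forall x, punctured_cube S x -> punctured_cube S' x -> g x = g' x) ->
  g (cst 0) = g' (cst 0).
Proof.
move=> Si S'i /subspace_continuousP gc /subspace_continuousP gc' gg'.
apply/eqP; rewrite -subr_eq0 -normr_le0; apply/ler_addgt0Pr => e e0.
have e2 : 0 < e / 2 by rewrite divr_gt0.
have n2 : \forall y \near (cst 0 : P), cube S y -> `|g (cst 0) - g y| < e / 2.
  by have /cvgrPdist_lt/(_ _ e2) := gc _ (cube_cst0 S).
have n1 : \forall y \near (cst 0 : P), cube S' y -> `|g' (cst 0) - g' y| < e / 2.
  by have /cvgrPdist_lt/(_ _ e2) := gc' _ (cube_cst0 S').
have [s s01 []] := nbhs_small_coord (cst 0) i _ erefl (filterI n1 n2).
have /andP[s0 s1] := s01; have s01' : 0 <= s <= 1 by rewrite ltW.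
have c0 := @cube_set_coord R I _ (cst 0) i s _ s01' (cube_cst0 _).
move=> /(_ (c0 _ S'i)) /= h1 /(_ (c0 _ Si)) /= h2.
have p0 S0 : S0 i -> punctured_cube S0 (set_coord (cst 0 : P) i s).
  by move=> S0i; exact: punctured_cube_set_coord (cube_cst0 _).
rewrite (gg' _ (p0 _ Si) (p0 _ S'i)) in h2.
rewrite add0r; have := ler_distD (g' (set_coord (cst 0) i s)) (g (cst 0)) (g' (cst 0)).
by rewrite (distrC (g' (set_coord _ _ _)) (g' (cst 0))); lra.
Qed.

End Dependence.

(** * Subspaces *)

Section Subspaces.
Context {X Y : topologicalType}.

Lemma continuous_set_type {A : set Y} (h : X -> set_type A) :
  continuous (fun z => set_val (h z)) -> continuous h.
Proof.
move=> hc z N [_ [[V oV <-] Vhz VN]]; apply: filterS VN _.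
by apply: hc; exact: open_nbhs_nbhs.
Qed.

Lemma continuous_set_val (A : set X) : continuous (@set_val _ A).
Proof. exact: (@initial_continuous A X set_val). Qed.

Lemma continuous_comp_within {Z : topologicalType} {A : set Y} (p : X -> Y)
    (G : Y -> Z) :
  continuous p -> (forall z, A (p z)) -> {within A, continuous G} ->
  continuous (G \o p).
Proof.
move=> pc pA /subspace_continuousP Gc z N GN.
have {}GN : nbhs (p z) (fun y => A y -> N (G y)) by exact: Gc (pA z) _ GN.
have : nbhs z (fun t => A (p t) -> N (G (p t))) by exact: pc z _ GN.
by apply: filterS => t /(_ (pA t)).
Qed.

Lemma set_val_mem {A : set X} (x : set_type A) : A (set_val x).
Proof. exact: set_valP. Qed.

Lemma set_val_surj (A : set X) y : A y -> exists x : set_type A, set_val x = y.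
Proof. by move=> Ay; exists (exist _ y (mem_set Ay)). Qed.

End Subspaces.

(** * The punctured complex of cubes *)

(** There are more than tau large coordinates by Cantor's theorem. The factor
    nat makes room for the countably many coordinates on which each of tau
    functions may depend. *)
Inductive coordinate (K : Type) :=
  | Small (k : K)
  | Large (q : set (K * nat))
  | SmallAxis
  | LargeAxis
  | LinkAxis.
Arguments Small {K} k.
Arguments Large {K} q.
Arguments SmallAxis {K}.
Arguments LargeAxis {K}.
Arguments LinkAxis {K}.

Section Space.
Import Order.TTheory GRing.Theory Num.Theory.
Import numFieldNormedType.Exports.
Local Open Scope ring_scope.
Context {R : realType} {K : Type}.
Context (K_uncountable : ~ countable [set: K]).
Local Notation I := (coordinate K).
Local Notation P := {ptws I -> R}.

Definition small_face : set I :=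
  fun i => match i with Small _ | SmallAxis => True | _ => False end.
Definition large_face : set I :=
  fun i => match i with Large _ | LargeAxis => True | _ => False end.
Definition small_link : set I :=
  fun i => match i with Small _ | LinkAxis => True | _ => False end.
Definition large_link : set I :=
  fun i => match i with Large _ | LinkAxis => True | _ => False end.

Definition complex : set P :=
  (cube small_face `|` cube large_face) `|` (cube small_link `|` cube large_link).

Definition punctured_complex : set P := [set x | complex x /\ exists i, x i != 0].

Lemma compact_complex : compact complex.
Proof. by do ![apply: compactU]; exact: compact_cube. Qed.

Lemma uncountable_face (S : set I) (f : K -> I) : injective f ->
  (forall k, S (f k)) -> ~ countable S.
Proof.
move=> fI fS /countable_injP[c cI]; apply: K_uncountable; apply/countable_injP.
exists (c \o f) => x y _ _ /= /cI; rewrite !inE => /(_ (fS x) (fS y)); exact: fI.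
Qed.

Lemma Small_injective : injective (@Small K).
Proof. by move=> x y []. Qed.

(** This injection shows that the large coordinates are uncountably many. *)
Let singleton_coord (k : K) : I := Large [set (k, 0%N)].

Lemma singleton_coord_injective : injective singleton_coord.
Proof.
by move=> x y [] /(congr1 (fun q => q (x, 0%N))) /= h; have [] : (x, 0%N) = (y, 0%N)
  by rewrite -[_ = _]h.
Qed.

(** On each cube the extension is x |-> g (x with x_i = 1) for an ignored
    coordinate i; these four functions paste to a continuous function on the
    complex. The last clause follows by comparing two ignored large coordinates
    on the same cube: with either one, the corner gets the same value. *)
Lemma space_extension (g : P -> R) : {within punctured_complex, continuous g} ->
  exists JG : set I * (P -> R), [/\ countable JG.1,
    {within complex, continuous JG.2},
    forall x, punctured_complex x -> JG.2 x = g x &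
    forall q, ~ JG.1 (Large q) ->
      JG.2 (cst 0) = JG.2 (set_coord (cst 0) (Large q) 1)].
Proof.
move=> gc.
have fc S : cube S `<=` complex -> {within punctured_cube S, continuous g}.
  by move=> SC; apply: continuous_subspaceW gc => x [/SC].
have ext S (f : K -> I) : injective f -> (forall k, S (f k)) ->
    cube S `<=` complex -> exists2 J, countable J & forall i, S i -> ~ J i ->
      {within cube S, continuous (fun x => g (set_coord x i 1))} /\
      forall x, punctured_cube S x -> g (set_coord x i 1) = g x.
  move=> fI Sf SC; apply: face_extension; first exact: uncountable_face fI Sf.
  exact: fc.
have [//|x|J1 cJ1 J1P] := ext small_face _ Small_injective; first by left; left.
have [//|x|J2 cJ2 J2P] := ext large_face _ singleton_coord_injective.
  by left; right.
have [//|x|J3 cJ3 J3P] := ext small_link _ Small_injective; first by right; left.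
have [//|x|J4 cJ4 J4P] := ext large_link _ singleton_coord_injective.
  by right; right.
pose J := (J1 `|` J2) `|` (J3 `|` J4).
have cJ : countable J by do ![apply: countable_setU => //].
have free (f : K -> I) : injective f -> exists k, ~ J (f k).
  move=> fI; apply: contrapT => nk; apply: (uncountable_face J f fI _ cJ) => k.
  by apply: contrapT => nJ; apply: nk; exists k.
have [k0 k0J] := free _ Small_injective.
have [k1 q0J] := free _ singleton_coord_injective.
pose h i := fun x => g (set_coord x i 1).
set q0 := singleton_coord k1 in q0J.
have [c1 e1] := J1P (Small k0) Logic.I (fun j => k0J (or_introl (or_introl j))).
have [c2 e2] := J2P q0 Logic.I (fun j => q0J (or_introl (or_intror j))).
have [c3 e3] := J3P (Small k0) Logic.I (fun j => k0J (or_intror (or_introl j))).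
have [c4 e4] := J4P q0 Logic.I (fun j => q0J (or_intror (or_intror j))).
(* Both cubes with small coordinates use the index k0, and both cubes with
   large ones use q0, so a single equality of values at the corner is needed. *)
have h0 : h (Small k0) (cst 0) = h q0 (cst 0).
  apply: (extensions_agree0 small_link large_link LinkAxis) => //.
  by move=> x Sx Sx'; rewrite /h e3// e4.
pose G x := if `[< exists i, x i != 0 >] then g x else h q0 (cst 0).
have Gface S i : {within cube S, continuous (h i)} ->
    (forall x, punctured_cube S x -> h i x = g x) ->
    h i (cst 0) = h q0 (cst 0) -> {within cube S, continuous G}.
  move=> hc hg hi0; apply: subspace_eq_continuous hc => x; rewrite inE => Sx.
  rewrite /G /from_subspace; case: asboolP => [nx|nx]; first by rewrite hg.
  rewrite -hi0; congr (h i _); apply/funext => j; apply/eqP.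
  by apply: contrapT => /negP xj; apply: nx; exists j.
have Gg x : punctured_complex x -> G x = g x.
  by move=> [_ nx]; rewrite /G; case: asboolP.
exists (J, G); split => //=.
- apply: withinU_continuous.
  + by apply: closedU; exact: closed_cube.
  + by apply: closedU; exact: closed_cube.
  + apply: withinU_continuous; [exact: closed_cube|exact: closed_cube|..].
      exact: Gface c1 e1 h0.
    exact: Gface c2 e2 erefl.
  + apply: withinU_continuous; [exact: closed_cube|exact: closed_cube|..].
      exact: Gface c3 e3 h0.
    exact: Gface c4 e4 erefl.
move=> q qJ.
have pq : punctured_cube large_link (set_coord (cst 0 : P) (Large q) 1).
  by apply: punctured_cube_set_coord (cube_cst0 _) => //; rewrite ltr01 lexx.
rewrite [RHS]Gg; last by split; [right; right; exact: pq.1|exact: pq.2].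
rewrite /G; case: asboolP => [[i]|_]; first by rewrite eqxx.
have [c5 e5] := J4P (Large q) Logic.I (fun j => qJ (or_intror (or_intror j))).
rewrite -[RHS]/(h (Large q) (cst 0)).
apply: (extensions_agree0 large_link large_link LinkAxis) => //.
by move=> x Sx Sx'; rewrite /h e4// e5.
Qed.

(** Cantor's diagonal argument: c k numbers the elements of J k, and D differs
    from every q with Large q in J k at the pair of k and the number of q. *)
Lemma large_coord_avoiding (J : K -> set I) : (forall k, countable (J k)) ->
  exists q, forall k, ~ J k (Large q).
Proof.
move=> cJ; have /choice[c cP] : forall k, exists f : I -> nat, {in J k &, injective f}.
  by move=> k; apply/countable_injP.
pose D : set (K * nat) := fun kn =>
  forall q, J kn.1 (Large q) -> c kn.1 (Large q) = kn.2 -> ~ q kn.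
exists D => k JD; pose n := c k (Large D).
have nD : ~ D (k, n) by move=> h; exact: (h D JD erefl).
apply: (nD) => q Jq cq; suff -> : q = D by [].
by have [] : Large q = Large D by apply: (cP k); rewrite ?inE.
Qed.

(** The image is that of the extension to the compact complex: the value at the
    corner is also taken at the unit point of a large coordinate which all
    coordinate functions of f ignore. *)
Lemma punctured_complex_pseudocompact :
  tau_pseudocompact R K (set_type punctured_complex).
Proof.
move=> f fc.
have /choice[JG JGP] : forall k, exists JG : set I * (P -> R),
    [/\ countable JG.1, {within complex, continuous JG.2},
    forall x : set_type punctured_complex, JG.2 (set_val x) = f x k &
    forall q, ~ JG.1 (Large q) ->
      JG.2 (cst 0) = JG.2 (set_coord (cst 0) (Large q) 1)].
  move=> k; pose fk (x : set_type punctured_complex) := f x k.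
  have fkc : continuous fk.
    by move=> x; apply: (@continuous_comp _ _ _ f (fun z => z k));
      [exact: fc|exact: continuous_coord].
  have /subspace_valL_continuousP' gc := fkc.
  have [JG [cJ Gc Gg G0]] := space_extension _ (gc 0).
  exists JG; split => // x; rewrite Gg; last exact: set_valP.
  exact: (congr1 (fun f' => f' x) (valLK 0 fk)).
pose F (x : P) : {ptws K -> R} := fun k => (JG k).2 x.
have Fc : {within complex, continuous F}.
  by apply: continuous_ptws => k; have [] := JGP k.
have -> : range f = F @` complex.
  apply/seteqP; split=> [_ [x _ <-]|_ [x Cx <-]].
    exists (set_val x); first by have [] := set_valP x.
    by apply/funext => k; have [_ _ + _] := JGP k; apply.
  have fF y : punctured_complex y -> range f (F y).
    move=> /(set_val_surj punctured_complex)[z <-]; exists z => //.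
    by apply/funext => k; have [_ _ Gf _] := JGP k; rewrite -Gf.
  have [nx|nx] := pselect (exists i, x i != 0); first by apply: fF.
  have -> : x = cst 0.
    apply/funext => j; apply/eqP.
    by apply: contrapT => /negP xj; apply: nx; exists j.
  have [|q qJ] := large_coord_avoiding (fun k => (JG k).1).
    by move=> k; have [] := JGP k.
  have -> : F (cst 0) = F (set_coord (cst 0) (Large q) 1).
    by apply/funext => k; have [_ _ _ G0] := JGP k; exact: G0.
  apply: fF; have [] : punctured_cube large_link (set_coord (cst 0 : P) (Large q) 1).
    by apply: punctured_cube_set_coord (cube_cst0 _) => //; rewrite ltr01 lexx.
  by move=> ? ?; split => //; right; right.
apply: compact_closed; first exact: hausdorff_ptws.
exact: continuous_compact Fc compact_complex.
Qed.

Definition punctured_space : topologicalType := set_type punctured_complex.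

Lemma tychonoff_punctured_complex : tychonoff_space punctured_space.
Proof.
split; last exact: (@uniform_completely_regular R).
apply: hausdorff_accessible => x y xy; apply: val_inj.
apply: (@hausdorff_ptws R I) => A B Ax By.
have [z [Az Bz]] := xy _ _ (continuous_set_val _ _ _ Ax) (continuous_set_val _ _ _ By).
by exists (set_val z).
Qed.

End Space.

(** * The two regular closed pieces *)

Section RegularClosedPieces.
Import Order.TTheory GRing.Theory Num.Theory.
Import numFieldNormedType.Exports.
Local Open Scope ring_scope.
Context {R : realType} {K : Type}.
Context (K_uncountable : ~ countable [set: K]).
Local Notation I := (coordinate K).
Local Notation P := {ptws I -> R}.
Local Notation X := (set_type (@punctured_complex R K)).

(** The map with coordinates x_k + x_u on the small face and x_k + x_u + 1 on
    the large one is continuous, since the two faces are disjoint and open in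
    their union. It never vanishes, but it tends to 0 along the axis u. *)
Lemma not_pseudocompact_of_small_face {T : topologicalType} (j : T -> P) (k0 : K) :
  continuous j ->
  (forall z, punctured_cube small_face (j z) \/ punctured_cube large_face (j z)) ->
  (forall s, 0 < s <= 1 -> exists z, j z = set_coord (cst 0) SmallAxis s) ->
  ~ tau_pseudocompact R K T.
Proof.
move=> jc jz js pcT.
pose ind (z : T) : R := if `[< cube small_face (j z) >] then 0 else 1.
have jcc i : continuous (fun z => j z i).
  by move=> z; apply: (@continuous_comp _ _ _ j (fun y => y i));
    [exact: jc|exact: continuous_coord].
have indc : continuous ind.
  move=> z; apply: cvg_near_cst.
  have near_neq0 i : j z i != 0 -> \forall w \near z, j w i != 0.
    move=> zi; apply: open_nbhs_nbhs; split => //.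
    apply: (@open_comp _ _ (fun w => j w i) [set a | a != 0]); last exact: open_neq.
    by move=> w _; exact: jcc.
  have disj w i : cube small_face (j w) -> j w i != 0 -> large_face i -> False.
    by move=> Sw wi; have := cube_neq0 _ _ _ Sw wi; case: i wi.
  have disj' w i : cube large_face (j w) -> j w i != 0 -> small_face i -> False.
    by move=> Sw wi; have := cube_neq0 _ _ _ Sw wi; case: i wi.
  case: (jz z) => -[Sz [i zi]]; have Si := cube_neq0 _ _ _ Sz zi;
    have := near_neq0 _ zi; apply: filterS => w wi; rewrite /ind.
    have -> : `[< cube small_face (j z) >] by apply/asboolP.
    case: asboolP => // nw; case: (jz w) => -[Sw _] //.
    by case: (disj' _ _ Sw wi Si).
  case: asboolP => [Sw|_]; first by case: (disj _ _ Sw wi Si).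
  by case: asboolP => // Sz'; case: (disj _ _ Sz' zi Si).
pose f (z : T) : {ptws K -> R} := fun k => j z (Small k) + j z SmallAxis + ind z.
have fc : continuous f.
  apply: continuous_ptws => k z.
  exact: (continuousD (continuousD (jcc (Small k) z) (jcc SmallAxis z)) (indc z)).
have : range f (cst 0).
  apply: (pcT f fc) => N N0.
  have cc : continuous (fun s : R => (fun=> s) : {ptws K -> R}).
    by apply: continuous_ptws => k s; exact: cvg_id.
  have [s s01 Ns] := nbhs0_small _ (cc 0 _ N0).
  have [z jzs] := js s s01; exists (f z); split; first by exists z.
  suff -> : f z = fun=> s by [].
  have s01' : 0 <= s <= 1 by have /andP[s0 ->] := s01; rewrite ltW.
  apply/funext => k; rewrite /f /ind jzs set_coord_eq set_coord_neq//.
  case: asboolP => [_|[]]; first by rewrite add0r addr0.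
  exact: cube_set_coord (cube_cst0 _).
case=> z _ fz0; have fk k : f z k = 0 by rewrite fz0.
rewrite /f /ind in fk; case: asboolP fk => [Sz|nSz] fk; last first.
  case: (jz z) => -[Sz _] //; have := fk k0.
  have := (Sz (Small k0)).1; have := (Sz SmallAxis).1; lra.
have [i Si /eqP []] : exists2 i, small_face i & j z i != 0.
  by case: (jz z) => -[_ [i zi]]; exists i => //; exact: cube_neq0 Sz zi.
have z0 k := (Sz k).1.
case: i Si => [k|q|||] // _.
  by have := fk k; have := z0 (Small k); have := z0 SmallAxis; lra.
by have := fk k0; have := z0 (Small k0); have := z0 SmallAxis; lra.
Qed.

Definition zero_piece : set X := [set x | (set_val x : P) LinkAxis = 0].
Definition retract_piece : set X := [set x | cube small_face (set_val x : P)].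

Lemma SmallAxis_face (x : P) : complex x -> x SmallAxis != 0 -> cube small_face x.
Proof.
by move=> [[|]|[|]] Sx xi //; have := cube_neq0 _ _ _ Sx xi.
Qed.

Lemma LargeAxis_face (x : P) : complex x -> x LargeAxis != 0 -> cube large_face x.
Proof.
by move=> [[|]|[|]] Sx xi //; have := cube_neq0 _ _ _ Sx xi.
Qed.

Lemma coord_continuous (i : I) : continuous (fun x : X => (set_val x : P) i).
Proof.
by move=> x; apply: (@continuous_comp _ _ _ set_val (fun y : P => y i));
  [exact: continuous_set_val|exact: continuous_coord].
Qed.

Lemma open_coord_neq0 (i : I) : open [set x : X | (set_val x : P) i != 0].
Proof.
apply: (@open_comp _ _ (fun x : X => (set_val x : P) i) [set a | a != 0]).
  by move=> w _; exact: coord_continuous.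
exact: open_neq.
Qed.

(** Moving along an axis i of the cube makes the i-th coordinate nonzero without
    leaving the cube. *)
Lemma closure_face (x : X) (S : set I) i (U : set X) : S i ->
  cube S `<=` @complex R K -> cube S (set_val x : P) ->
  (forall z : X, cube S (set_val z : P) -> (set_val z : P) i != 0 -> U z) ->
  closure U x.
Proof.
move=> Si SC Sx SU.
have [xi0|xi] := eqVneq ((set_val x : P) i) 0; last first.
  by apply: subset_closure; exact: SU.
move=> N [_ [[V oV <-] Vx VN]].
have [|s s01 Vs] := nbhs_small_coord (set_val x : P) i V xi0.
  exact: open_nbhs_nbhs.
have [Ss nz] := punctured_cube_set_coord _ _ _ _ Si s01 Sx.
have [z zE] := set_val_surj punctured_complex (set_coord (set_val x : P) i s)
  (conj (SC _ Ss) nz).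
exists z; split; last by apply: VN; rewrite /preimage/= zE.
by apply: SU; rewrite zE// set_coord_eq; have /andP[/gt_eqF->] := s01.
Qed.

Lemma zero_set_zero_piece : zero_set R zero_piece.
Proof.
exists (fun x : X => (set_val x : P) LinkAxis); split => //.
  exact: coord_continuous.
by move=> x; have [[[]|[]] Sx _] := set_val_mem x; exact: (Sx _).1.
Qed.

Lemma closed_zero_piece : closed zero_piece.
Proof.
apply: (@preimage_closed _ _ (fun x : X => (set_val x : P) LinkAxis) [set 0]).
  by move=> w _; exact: coord_continuous.
exact: closed_eq.
Qed.

Lemma closed_retract_piece : closed retract_piece.
Proof.
apply: (@preimage_closed _ _ set_val (cube small_face)).
  by move=> w _; exact: continuous_set_val.
exact: closed_cube.
Qed.

Lemma zero_piece_face (x : X) : zero_piece x ->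
  cube small_face (set_val x : P) \/ cube large_face (set_val x : P).
Proof.
move=> x0; have [C _] := set_val_mem x.
case: C => -[] Sx; [by left|by right|left|right] => i; have [xi ni] := Sx i;
  split => // Fi; case: i Fi xi ni => // *; try exact: x0; by auto.
Qed.

Lemma regular_closed_zero_piece : regular_closed zero_piece.
Proof.
exists ([set x : X | (set_val x : P) SmallAxis != 0] `|`
        [set x : X | (set_val x : P) LargeAxis != 0]).
  by apply: openU; exact: open_coord_neq0.
apply/seteqP; split => x.
  case/zero_piece_face => Sx.
    apply: (closure_face _ small_face SmallAxis) => //.
      by move=> y; left; left.
    by move=> y _; left.
  apply: (closure_face _ large_face LargeAxis) => //.
    by move=> y; left; right.
  by move=> y _; right.
move=> xU; apply: closed_zero_piece; apply: closure_subset xU => y.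
by have [C _] := set_val_mem y => -[/(SmallAxis_face _ C)|/(LargeAxis_face _ C)]
  /(_ LinkAxis)[_]; apply.
Qed.

Lemma regular_closed_retract_piece : regular_closed retract_piece.
Proof.
exists [set x : X | (set_val x : P) SmallAxis != 0]; first exact: open_coord_neq0.
apply/seteqP; split => x.
  move=> Sx; apply: (closure_face _ small_face SmallAxis) => //.
  by move=> y; left; left.
move=> xU; apply: closed_retract_piece; apply: closure_subset xU => y.
by have [C _] := set_val_mem y => /(SmallAxis_face _ C).
Qed.

Lemma small_axis_point (s : R) : 0 < s <= 1 ->
  exists2 x : X, retract_piece x & set_val x = set_coord (cst 0 : P) SmallAxis s.
Proof.
move=> s01; have s01' : 0 <= s <= 1 by have /andP[s0 ->] := s01; rewrite ltW.
have [Ss nz] : punctured_cube small_face (set_coord (cst 0 : P) SmallAxis s).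
  exact: punctured_cube_set_coord (cube_cst0 _).
have [x xE] := set_val_surj punctured_complex (set_coord (cst 0 : P) SmallAxis s)
  (conj (or_introl (or_introl Ss)) nz).
by exists x; rewrite /retract_piece /= ?xE.
Qed.

Lemma piece_not_pseudocompact (H : set X) : H `<=` zero_piece ->
  retract_piece `<=` H -> ~ tau_pseudocompact R K (set_type H).
Proof.
move=> HA BH.
have [k0] : exists k0 : K, True.
  apply: contrapT => nk; apply: K_uncountable.
  suff -> : [set: K] = set0 by exact: countable0.
  by apply/seteqP; split=> // k _; apply: nk; exists k.
move=> _; apply: (not_pseudocompact_of_small_face
  (fun z : set_type H => set_val (set_val z : X)) k0).
- move=> z; apply: (@continuous_comp _ _ _ (@set_val _ H) (@set_val _ _)).
    exact: continuous_set_val.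
  exact: continuous_set_val.
- move=> z; have [_ nz] := set_val_mem (set_val z : X).
  by case: (zero_piece_face _ (HA _ (set_val_mem z))); [left|right].
move=> s /small_axis_point[x Bx xs].
by have [z zx] := set_val_surj H x (BH _ Bx); exists z; rewrite zx.
Qed.

(** A function on the punctured small cube extends over the corner; composed
    with the retraction r of the complex onto that cube, which kills the other
    coordinates and may send points to the corner, it extends to all of X. *)
Lemma C_embedded_retract_piece : C_embedded R retract_piece.
Proof.
move=> f fc.
have lift (z : set_type (@punctured_cube R I small_face)) :
    exists b : set_type retract_piece, set_val (set_val b) = set_val z.
  have [Sz nz] := set_val_mem z.
  have [x xz] := set_val_surj punctured_complex (set_val z)
    (conj (or_introl (or_introl Sz)) nz).
  have [|b bx] := set_val_surj retract_piece x _; last by exists b; rewrite bx.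
  by rewrite /retract_piece /= xz.
have /choice[p pE] := lift.
have pc : continuous p.
  do 2 apply: continuous_set_type.
  have -> : (fun z => set_val (set_val (p z))) = set_val by exact/funext.
  exact: continuous_set_val.
have /subspace_valL_continuousP' gc : continuous (f \o p).
  by move=> z; apply: continuous_comp; [exact: pc|exact: fc].
have uS : ~ countable (@small_face K).
  exact: (uncountable_face K_uncountable _ Small Small_injective).
have [J cJ JP] := face_extension _ _ uS (gc 0).
have [k0 k0J] : exists k, ~ J (Small k).
  apply: contrapT => nk.
  apply: (uncountable_face K_uncountable J Small Small_injective _ cJ) => k.
  by apply: contrapT => nJ; apply: nk; exists k.
have [Gc Gg] := JP (Small k0) Logic.I k0J.
pose G (x : P) : R := valL_ 0 (f \o p) (set_coord x (Small k0) 1).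
pose r (x : P) : P := fun i => if `[< small_face i >] then x i else 0.
have rc : continuous r.
  apply: continuous_ptws => i; rewrite /r.
  by case: asboolP => _; [exact: continuous_coord|exact: (@cst_continuous _ _ 0)].
exists (G \o (fun x : X => r (set_val x))).
  apply: (@continuous_comp_within _ _ _ (cube small_face)) => //.
    by move=> x; apply: (@continuous_comp _ _ _ set_val r);
      [exact: continuous_set_val|exact: rc].
  move=> x i; rewrite /r; case: asboolP => [Si|]; last by rewrite lexx ler01.
  by split => //; have [[[]|[]] Sx _] := set_val_mem x; exact: (Sx _).1.
move=> b /=; have Sb : retract_piece (val b) := set_val_mem b.
have [Cb nb] := set_val_mem (val b).
have -> : r (set_val (val b)) = set_val (val b).
  apply/funext => i; rewrite /r; case: asboolP => // /(proj2 (Sb i)) e.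
  by rewrite e.
rewrite /G Gg//.
have [z zb] := set_val_surj (punctured_cube small_face) (set_val (val b) : P)
  (conj Sb nb).
rewrite -zb -[LHS]/(sigL _ (valL_ 0 (f \o p)) z) valLK /=.
congr f; apply: val_inj; apply: val_inj; exact: etrans (pE z) zb.
Qed.

End RegularClosedPieces.

(* [~ countable [set: K]] says that tau = |K| is at least omega_1, the least
   uncountable cardinal. *)
Theorem mainTheorem1 (R : realType) (K : Type) (K_uncountable : ~ countable [set: K]) :
  exists X : topologicalType,
    tychonoff_space X /\ tau_pseudocompact R K X /\
    exists A B : set X,
      [/\ regular_closed A, regular_closed B, zero_set R A & C_embedded R B] /\
      ~ tau_pseudocompact R K (set_type A) /\
      ~ tau_pseudocompact R K (set_type B).
Proof.
exists (@punctured_space R K); split.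
  exact: tychonoff_punctured_complex.
split; first exact: punctured_complex_pseudocompact.
exists zero_piece, retract_piece; split.
  split.
  - exact: regular_closed_zero_piece.
  - exact: regular_closed_retract_piece.
  - exact: zero_set_zero_piece.
  - exact: C_embedded_retract_piece.
have BA : @retract_piece R K `<=` zero_piece.
  by move=> x /(_ LinkAxis)[_]; apply.
by split; apply: piece_not_pseudocompact.
Qed.
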